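(* Let $a\in\Delta$ with $a_i>0$ for all $1\le i\le d$, and let $t>0$ be fixed. As $N\to\infty$ through positive integers for which $k=Na\in\mathbb{Z}^d$, $$\sigma_{N,k}([t,\infty))\;\sim\;\pi^d\,\gamma_d\prod_{i=1}^d\left(a_i\,\frac dN\log N\right)^{1/2},$$ i.e. the ratio of the two sides tends to $1$.
   Context: Let $G$ be a subtorus of $T^d=(S^1)^d$ with Lie algebra $\mathfrak g\subset\mathbb{R}^d$, let $L:(\mathbb{R}^d)^*\to\mathfrak g^*$ be the dual of the inclusion, $e_1^*,\dots,e_d^*$ the standard dual basis, $\alpha_i=Le_i^*$, and let $\lambda\in\mathbb{Z}_G^*$ be a weight of $G$ such that the reduction of $\mathbb{C}^d$ by $G$ at $\lambda$ is a compact toric (Kähler) manifold; $\Delta=\{x\in\mathbb{R}^d:\ x_i\ge0,\ \sum_ix_i\alpha_i=\lambda\}$. For $k\in\mathbb{Z}_{\ge0}^d$ and a positive integer $N$, let $z^k=z_1^{k_1}\cdots z_d^{k_d}$, let $dz\,d\bar z$ denote Lebesgue measure on $\mathbb{C}^d$, let $c_{N,k}^2=\int_{\mathbb{C}^d}|z^k|^2e^{-N|z|^2}dz\,d\bar z=\left(\frac\pi N\right)^d\prod_i\frac{k_i!}{N^{k_i}}$, and let $$\langle s_k,s_k\rangle(z)=\frac1{c_{N,k}^2}|z^k|^2e^{-N|z|^2},\qquad \sigma_{N,k}([t,\infty))=\operatorname{Vol}\{z\in\mathbb{C}^d:\ \langle s_k,s_k\rangle(z)\ge t\},$$ where $\operatorname{Vol}$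 is Lebesgue measure. $\gamma_d$ is the volume of the unit ball in $\mathbb{R}^d$. *)

(* Defs.v *)
(* Built on MathComp-Analysis; C is R[i] from mathcomp-real-closed, for an
   arbitrary R : realType. *)
From HB Require Import structures.
From mathcomp Require Import all_boot all_order all_algebra.
From mathcomp Require Import complex.
From mathcomp Require Import all_classical all_reals all_analysis.

Set Implicit Arguments.
Unset Strict Implicit.
Unset Printing Implicit Defensive.
Import Order.TTheory GRing.Theory Num.Theory.
Import numFieldNormedType.Exports.

Local Open Scope classical_set_scope.
Local Open Scope ring_scope.
Local Open Scope quotient_scope.
Import Normc.

(* The usual (norm) topology of C. *)
HB.instance Definition _ (R : realType) :=
  PseudoPointedMetric.copy R[i] (R[i])^o.

Section sigma_finite_product.
Local Open Scope ereal_scope.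
Context {d1 d2 : measure_display} {T1 : measurableType d1}
  {T2 : measurableType d2} {R : realType}.
Variables (m1 : {sigma_finite_measure set T1 -> \bar R})
  (m2 : {sigma_finite_measure set T2 -> \bar R}).

(* An alias of the product measure: unification no longer finds the
   sigma-finite structure of m1 \x m2, which later instances of the library
   for (sub)probabilities shadow. *)
Definition sfprod : set (T1 * T2) -> \bar R := m1 \x m2.

HB.instance Definition _ := Measure.copy sfprod (m1 \x m2).

Let sfprod_sigma_finite : sigma_finite setT sfprod.
Proof.
have /sigma_finiteP[F [TF ndF Foo]] := sigma_finiteT m1.
have /sigma_finiteP[G [TG ndG Goo]] := sigma_finiteT m2.
exists (fun n => F n `*` G n).
  rewrite -setXTT TF TG predeqE => -[x y]; split.
    move=> [/= [n _ Fnx] [k _ Gky]]; exists (maxn n k) => //; split.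
    - by move: x Fnx; exact/subsetPset/ndF/leq_maxl.
    - by move: y Gky; exact/subsetPset/ndG/leq_maxr.
  by move=> [n _ []/= ? ?]; split; exists n.
move=> k; have [? ?] := Foo k; have [? ?] := Goo k.
split; first exact: measurableX.
by rewrite /sfprod product_measure1E// lte_mul_pinfty// ge0_fin_numE.
Qed.

HB.instance Definition _ := Measure_isSigmaFinite.Build _ _ _ sfprod
  sfprod_sigma_finite.

End sigma_finite_product.

Section tensor_power.
Context {dT : measure_display} {T : measurableType dT} {R : realType}.
Variable mu : {sigma_finite_measure set T -> \bar R}.

Definition cons_pair n (p : T * n.-tuple T) : n.+1.-tuple T :=
  [tuple of p.1 :: p.2].

Lemma measurable_cons_pair n : measurable_fun [set: T * n.-tuple T] (@cons_pair n).
Proof. exact: measurable_cons. Qed.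

Section step.
Variables (n : nat) (nu : {sigma_finite_measure set (n.-tuple T) -> \bar R}).

Definition tensor_step : set (n.+1.-tuple T) -> \bar R :=
  pushforward (sfprod mu nu) (@cons_pair n).

Let tensor_step0 : tensor_step set0 = 0%E.
Proof. by rewrite /tensor_step /pushforward preimage_set0 measure0. Qed.

Let tensor_step_ge0 A : (0 <= tensor_step A)%E.
Proof. by rewrite /tensor_step /pushforward; apply: (measure_ge0 (sfprod mu nu)). Qed.

Let tensor_step_sigma_additive : semi_sigma_additive tensor_step.
Proof.
move=> F mF tF mUF; rewrite /tensor_step /pushforward preimage_bigcup.
have mc := @measurable_cons_pair n.
apply: measure_semi_sigma_additive.
- by move=> i; rewrite -[X in measurable X]setTI; exact: mc.
- apply/trivIsetP => /= i j _ _ ij; rewrite -preimage_setI.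
  by move/trivIsetP : tF => /(_ _ _ _ _ ij) ->//; rewrite preimage_set0.
- by rewrite -preimage_bigcup -[X in measurable X]setTI; exact: mc.
Qed.

HB.instance Definition _ := isMeasure.Build _ _ _ tensor_step
  tensor_step0 tensor_step_ge0 tensor_step_sigma_additive.

Let tensor_step_sigma_finite : sigma_finite setT tensor_step.
Proof.
have [F TF Foo] := sigma_finiteT (sfprod mu nu).
pose g (s : n.+1.-tuple T) := (thead s, [tuple of behead s]).
have gK : cancel (@cons_pair n) g.
  by move=> [x s]; congr pair; apply/val_inj.
have mg : measurable_fun [set: n.+1.-tuple T] g.
  apply/measurable_fun_pairP; split.
    exact: measurable_tnth.
  exact: measurable_behead.
exists (fun k => g @^-1` F k).
  by rewrite -preimage_bigcup -TF preimage_setT.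
move=> k; have [mFk Fkoo] := Foo k; split.
  by rewrite -[X in measurable X]setTI; exact: mg.
rewrite /tensor_step /pushforward -comp_preimage.
by rewrite (_ : g \o _ = id) //; apply/funext => x /=; rewrite gK.
Qed.

HB.instance Definition _ := @Measure_isSigmaFinite.Build _ _ _ tensor_step
  tensor_step_sigma_finite.

End step.

(* The n-fold product measure mu \x ... \x mu on n.-tuple T. *)
Fixpoint tensor_power (n : nat) :
    {sigma_finite_measure set (n.-tuple T) -> \bar R} :=
  match n with
  | 0 => [the {sigma_finite_measure set (0.-tuple T) -> \bar R} of
            dirac [tuple]]
  | n'.+1 => [the {sigma_finite_measure set (n'.+1.-tuple T) -> \bar R} of
            tensor_step (tensor_power n')]
  end.

End tensor_power.

Section spectral_measure.
Context {R : realType} {d : nat}.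

Local Notation leb := (@lebesgue_measure R).

Definition lebesgueR (n : nat) :
    {sigma_finite_measure set (n.-tuple (measurableTypeR R)) -> \bar R} :=
  tensor_power leb n.

(* Volume of the Euclidean unit ball of R^n. *)
Definition unit_ball_volume (n : nat) : R :=
  fine (lebesgueR n [set x | \sum_(i < n) (tnth x i : R) ^+ 2 <= 1]).

(* Lebesgue measure on C^d in the coordinates ((x_1, y_1), ..., (x_d, y_d)),
   where z_i = x_i + i y_i. *)
Definition lebesgueC : {sigma_finite_measure
    set (d.-tuple (measurableTypeR R * measurableTypeR R)%type) -> \bar R} :=
  tensor_power (sfprod leb leb) d.

Definition of_coords (p : d.-tuple (measurableTypeR R * measurableTypeR R)%type) :
    'rV[R[i]]_d := \row_i ((tnth p i).1 +i* (tnth p i).2)%C.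

Definition sqnorm (z : 'rV[R[i]]_d) : R := \sum_i normc (z 0 i) ^+ 2.

Definition monomial (k : 'I_d -> nat) (z : 'rV[R[i]]_d) : R[i] :=
  \prod_i z 0 i ^+ k i.

Definition density (N : nat) (k : 'I_d -> nat) (z : 'rV[R[i]]_d) : R :=
  normc (monomial k z) ^+ 2 * expR (- (N%:R * sqnorm z)).

(* c_{N,k}^2 *)
Definition sq_const (N : nat) (k : 'I_d -> nat) : R :=
  \int[lebesgueC]_p density N k (of_coords p).

(* <s_k, s_k>(z) *)
Definition pointwise_sqnorm (N : nat) (k : 'I_d -> nat) (z : 'rV[R[i]]_d) : R :=
  (sq_const N k)^-1 * density N k z.

(* sigma_{N,k}([t, +oo)) *)
Definition sigma_tail (N : nat) (k : 'I_d -> nat) (t : R) : \bar R :=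
  lebesgueC [set p | t <= pointwise_sqnorm N k (of_coords p)].

(* The positive integers N for which N a lies in Z^d. *)
Definition admissible (a : 'rV[R]_d) (N : nat) : Prop :=
  (0 < N)%N /\ forall i, N%:R * a 0 i \is a Num.int.

End spectral_measure.
Arguments unit_ball_volume : clear implicits.

Section reduction.
Context {R : realType} {d : nat}.
Implicit Types (t z w : 'rV[R[i]]_d) (v x : 'rV[R]_d).

Definition cmul t z : 'rV[R[i]]_d := map2_mx *%R t z.

(* T^d inside C^d; it acts on C^d by cmul. *)
Definition torus : set 'rV[R[i]]_d := [set t | forall i, normc (t 0 i) = 1].

(* A subtorus is a closed connected subgroup of T^d. *)
Record subtorus := Subtorus {
  subtorus_set : set 'rV[R[i]]_d;
  subtorus_sub : subtorus_set `<=` torus;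
  subtorus1 : subtorus_set (const_mx 1);
  subtorusM : forall t1 t2,
    subtorus_set t1 -> subtorus_set t2 -> subtorus_set (cmul t1 t2);
  subtorusV : forall t, subtorus_set t -> subtorus_set (map_mx GRing.inv t);
  subtorus_closed : closed subtorus_set;
  subtorus_connected : connected subtorus_set }.

(* Normalized so that the kernel of exp : R^d -> T^d is Z^d and the weight
   lattice of T^d is spanned by the e_i^*. *)
Definition expT v : 'rV[R[i]]_d :=
  \row_j (cos (2 * pi * v 0 j) +i* sin (2 * pi * v 0 j))%C.

Definition lie_algebra_of (G : subtorus) (g : {vspace 'rV[R]_d}) : Prop :=
  forall v, v \in g <-> forall s : R, subtorus_set G (expT (s *: v)).

Section weights.
Variable g : {vspace 'rV[R]_d}.

(* The dual L of the inclusion of g in R^d. *)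
Definition dual_incl (f : 'Hom('rV[R]_d, R^o)) : 'Hom(subvs_of g, R^o) :=
  (f \o linfun vsval)%VF.

Definition dual_basis (i : 'I_d) : 'Hom('rV[R]_d, R^o) :=
  linfun (fun v => v 0 i : R^o).

Definition alpha (i : 'I_d) : 'Hom(subvs_of g, R^o) := dual_incl (dual_basis i).

(* Elements of Z_G^*: they take integer values on the kernel of exp : g -> G. *)
Definition is_weight (lam : 'Hom(subvs_of g, R^o)) : Prop :=
  forall v : subvs_of g,
    expT (vsval v) = const_mx 1 -> (lam v : R) \is a Num.int.

Definition polytope (lam : 'Hom(subvs_of g, R^o)) : set 'rV[R]_d :=
  [set x | (forall i, 0 <= x 0 i) /\ \sum_i x 0 i *: alpha i = lam].

(* Normalized, without a factor 1/2 or a sign, so that the image of its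
   lam-level set under z |-> (|z_i|^2)_i is polytope lam. *)
Definition moment_map z : 'Hom(subvs_of g, R^o) :=
  \sum_i normc (z 0 i) ^+ 2 *: alpha i.

Definition level_set (lam : 'Hom(subvs_of g, R^o)) : set 'rV[R[i]]_d :=
  [set z | moment_map z = lam].

End weights.

Section orbit_space.
Variable G : subtorus.

Definition same_orbit : rel 'rV[R[i]]_d :=
  fun z w => `[< exists2 t, subtorus_set G t & w = cmul t z >].

Lemma same_orbit_refl : reflexive same_orbit.
Proof.
move=> z; apply/asboolP; exists (const_mx 1); first exact: subtorus1.
by apply/rowP => i; rewrite !mxE mul1r.
Qed.

Lemma same_orbit_sym : symmetric same_orbit.
Proof.
suff H z w : same_orbit z w -> same_orbit w z by move=> z w; apply/idP/idP; exact: H.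
move=> /asboolP[t Gt ->]; apply/asboolP; exists (map_mx GRing.inv t).
  exact: subtorusV.
apply/rowP => i; rewrite !mxE mulKf//.
apply/eqP => ti0; have := subtorus_sub Gt i.
by rewrite ti0 normc0 => /esym/eqP; rewrite oner_eq0.
Qed.

Lemma same_orbit_trans : transitive same_orbit.
Proof.
move=> w z u /asboolP[t1 Gt1 ->] /asboolP[t2 Gt2 ->]; apply/asboolP.
exists (cmul t2 t1); first exact: subtorusM.
by apply/rowP => i; rewrite !mxE mulrA.
Qed.

Canonical same_orbit_equiv :=
  EquivRel same_orbit same_orbit_refl same_orbit_sym same_orbit_trans.

(* C^d / G with the quotient topology. *)
Definition orbit_space := quotient_topology {eq_quot same_orbit}.

HB.instance Definition _ := Topological.on orbit_space.
HB.instance Definition _ := Quotient.on orbit_space.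

Variable g : {vspace 'rV[R]_d}.

Definition reduced_space (lam : 'Hom(subvs_of g, R^o)) : set orbit_space :=
  (\pi_orbit_space : 'rV[R[i]]_d -> orbit_space) @` level_set lam.

(* The reduction is a smooth (Kaehler) manifold because G acts freely on the
   level set: lam is then a regular value of the moment map and the
   Kaehler structure of C^d descends to the quotient. It is toric by the action
   of T^d / G, whose dimension is half that of the reduction. *)
Record compact_toric_reduction (lam : 'Hom(subvs_of g, R^o)) : Prop := {
  reduction_free : forall t z,
    subtorus_set G t -> level_set lam z -> cmul t z = z -> t = const_mx 1;
  reduction_compact : compact (reduced_space lam);
  reduction_connected : connected (reduced_space lam);
  reduction_effective : forall t, torus t ->
    (forall z, level_set lam z ->
       \pi_orbit_space (cmul t z) = \pi_orbit_space z) ->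
    subtorus_set G t }.

End orbit_space.
End reduction.
Arguments torus : clear implicits.
Arguments subtorus : clear implicits.

(* Main.v *)
Require Import Defs.
From HB Require Import structures.
From mathcomp Require Import all_boot all_order all_algebra.
From mathcomp Require Import complex.
From mathcomp Require Import all_classical all_reals all_analysis.
From mathcomp Require Import measurable_realfun.
From mathcomp Require Import ring lra.

Set Implicit Arguments.
Unset Strict Implicit.
Unset Printing Implicit Defensive.
Import Order.TTheory GRing.Theory Num.Theory.
Import numFieldNormedType.Exports.

Local Open Scope classical_set_scope.
Local Open Scope ring_scope.

(** The function <s_k, s_k> depends on z only through r_i = |z_i|^2; in these
coordinates the statement is Laplace's method for a product of one-variable
densities.

Lebesgue measure on C is pushed forward by z |-> |z|^2 to pi times Lebesgue
measure on [0, +oo[ ([rescales_norm2]).  The product structure of Lebesgue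
measure on C^d lifts such one-variable rescalings to C^d ([rescales_tensor]),
and it factors the integral c_{N,k}^2 into Gamma integrals.  Hence
<s_k, s_k>(z) is the product over i of
  w_i(r_i) = N^(k_i + 1) / (pi k_i!) * r_i^(k_i) * exp(- N r_i).
Put r_i = a_i u_i with k_i = N a_i.  A Stirling estimate with bounded error
gives
  ln w_i(a_i u_i) = (ln N) / 2 - N a_i phi(u_i) + O(1),  phi(u) = u - 1 - ln u,
uniformly in N and u_i ([ln_radial_density]).  So <s_k, s_k> >= t means
  sum_i a_i phi(u_i) <= (d/2) (ln N) / N + O(1 / N).
As phi(u) is (u - 1)^2 / 2 to second order at 1, in the coordinates
v_i = (r_i - a_i) / s_i with s_i = sqrt (a_i (d / N) ln N) the left-hand side
is (d/2) ((ln N) / N) |v|^2 up to a factor close to 1, and the region is caught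
between the balls of radius 1 - e and 1 + e as soon as N is large
([eball_sub_tail], [tail_sub_eball]).  Going back from v to z multiplies volumes
by pi^d prod_i s_i ([sigma_tail_rescaled]), which is the asserted equivalent
once divided by the volume of the unit ball.  The bounded error disappears in the
limit because it is compared with ln N. *)

(** * Maps that rescale a measure *)

Section rescaling.
Local Open Scope ereal_scope.
Context {R : realType}.

(** The constraint to subsets of [D] covers maps such as z |-> |z|^2, whose image
measure is a multiple of Lebesgue measure only on its range. *)
Definition rescales {d d'} {T : measurableType d} {T' : measurableType d'}
    (mu : set T -> \bar R) (nu : set T' -> \bar R) (D : set T') (c : R)
    (f : T -> T') :=
  forall A, measurable A -> A `<=` D -> mu (f @^-1` A) = c%:E * nu A.

Lemma rescales_comp {d1 d2 d3} {T1 : measurableType d1}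
    {T2 : measurableType d2} {T3 : measurableType d3}
    (mu : set T1 -> \bar R) (nu : set T2 -> \bar R) (rho : set T3 -> \bar R)
    (D : set T2) (E : set T3) (b c : R) (f : T1 -> T2) (g : T2 -> T3) :
  measurable_fun [set: T2] g -> g @^-1` E `<=` D ->
  rescales mu nu D b f -> rescales nu rho E c g ->
  rescales mu rho E (b * c)%R (g \o f).
Proof.
move=> mg ED hf hg A mA AE; rewrite comp_preimage hf.
- by rewrite hg// muleA.
- by rewrite -[X in measurable X]setTI; exact: mg.
- by move=> x /AE; exact: ED.
Qed.

Lemma ge0_integral_rescales {d d'} {T : measurableType d}
    {T' : measurableType d'} (mu : {measure set T -> \bar R})
    (nu : {measure set T' -> \bar R}) (D : set T') (c : R) (f : T -> T')
    (h : T' -> \bar R) :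
  measurable D -> (0 <= c)%R -> measurable_fun [set: T] f ->
  rescales mu nu D c f -> measurable_fun [set: T'] h -> (forall y, 0 <= h y) ->
  (forall y, ~ D y -> h y = 0) ->
  \int[mu]_x h (f x) = c%:E * \int[nu]_y h y.
Proof.
move=> mD c0 mf hf mh h0 hD.
have -> : \int[mu]_x h (f x) = \int[pushforward mu f]_y h y.
  by rewrite ge0_integral_pushforward.
have hDE (m : {measure set T' -> \bar R}) : \int[m]_y h y = \int[m]_(y in D) h y.
  rewrite [RHS]integral_mkcond; apply: eq_integral => y _.
  rewrite patchE; case: ifPn => //; rewrite notin_setE; exact: hD.
rewrite !hDE (_ : c = (NngNum c0)%:num)%R// -ge0_integral_mscale//; last first.
  exact: measurable_funS mh.
apply: eq_measure_integral => A mA AD.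
by rewrite /= /mscale/= -hf.
Qed.
End rescaling.

Section product_rescaling.
Local Open Scope ereal_scope.
Context {R : realType}.

(** The product measure of [A] integrates the measures of its sections; the
section at [x] of the preimage of [A] is the preimage of the section at [f1 x],
so both factors can be changed one after the other. *)
Lemma rescales_prod {d1 d2 d1' d2'} {T1 : measurableType d1}
    {T2 : measurableType d2} {U1 : measurableType d1'} {U2 : measurableType d2'}
    (m1 : {sigma_finite_measure set T1 -> \bar R})
    (m2 : {sigma_finite_measure set T2 -> \bar R})
    (n1 : {sigma_finite_measure set U1 -> \bar R})
    (n2 : {sigma_finite_measure set U2 -> \bar R})
    (D1 : set U1) (D2 : set U2) (c1 c2 : R) (f1 : T1 -> U1) (f2 : T2 -> U2) :
  measurable D1 -> (0 <= c1)%R -> (0 <= c2)%R ->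
  measurable_fun [set: T1] f1 ->
  rescales m1 n1 D1 c1 f1 -> rescales m2 n2 D2 c2 f2 ->
  rescales (sfprod m1 m2) (sfprod n1 n2) (D1 `*` D2) (c1 * c2)%R
    (fun p => (f1 p.1, f2 p.2)).
Proof.
move=> mD1 c10 c20 mf1 h1 h2 A mA AD; rewrite /sfprod /product_measure1.
have mA' : measurable_fun [set: U1] (n2 \o xsection A) by exact: measurable_fun_xsection.
have AD1 y : ~ D1 y -> xsection A y = set0.
  move=> Dy; rewrite -subset0 => z.
  by rewrite /xsection/= inE => /AD[].
rewrite EFinM -muleA -ge0_integralZl//=.
- transitivity (\int[m1]_x (c2%:E * n2 (xsection A (f1 x)))).
    apply: eq_integral => x _ /=.
    rewrite -h2//; last first.
    + by move=> z; rewrite /xsection/= inE => /AD[].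
    + exact: measurable_xsection.
  rewrite (@ge0_integral_rescales _ _ _ _ _ _ n1 D1 c1 f1 (fun y => c2%:E * n2 (xsection A y)))//.
  + exact: measurable_funeM.
  + by move=> y; apply: mule_ge0; rewrite ?lee_fin.
  + by move=> y /AD1 ->; rewrite measure0 mule0.
Qed.

End product_rescaling.

(** * Product measures on tuples *)

Section tensor_power_theory.
Local Open Scope ereal_scope.
Context {R : realType}.

Definition tmap {d d'} {T : measurableType d} {T' : measurableType d'} n
  (f : 'I_n -> T -> T') (s : n.-tuple T) : n.-tuple T' :=
  [tuple f i (tnth s i) | i < n].

Lemma tmap_cons {d d'} {T : measurableType d} {T' : measurableType d'} n
    (f : 'I_n.+1 -> T -> T') (p : T * n.-tuple T) :
  tmap f (cons_pair p) =
  cons_pair (f ord0 p.1, tmap (fun i => f (lift ord0 i)) p.2).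
Proof.
apply: eq_from_tnth => i; rewrite tnth_mktuple /cons_pair.
case: (unliftP ord0 i) => [j|] ->; last by rewrite !tnth0.
by rewrite !tnthS tnth_mktuple.
Qed.

Lemma rescales_tensor {d d'} {T : measurableType d} {T' : measurableType d'}
    (mu : {sigma_finite_measure set T -> \bar R})
    (nu : {sigma_finite_measure set T' -> \bar R}) n
    (D : 'I_n -> set T') (c : 'I_n -> R) (f : 'I_n -> T -> T') :
  (forall i, measurable (D i)) -> (forall i, 0 <= c i)%R ->
  (forall i, measurable_fun [set: T] (f i)) ->
  (forall i, rescales mu nu (D i) (c i) (f i)) ->
  rescales (tensor_power mu n) (tensor_power nu n)
    [set s | forall i, D i (tnth s i)] (\prod_i c i)%R (tmap f).
Proof.
elim: n D c f => [|n ih] D c f mD c0 mf hf.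
  move=> A mA _; rewrite big_ord0 mul1e /= /dirac !indicE.
  by congr (_%:R%:E); congr nat_of_bool; apply/idP/idP; rewrite !inE /= (tuple0 (tmap f _)).
move=> A mA AD.
have cl0 : (0 <= \prod_(i < n) c (lift ord0 i))%R by exact: prodr_ge0.
have tail := ih _ _ _ (fun i => mD (lift ord0 i)) (fun i => c0 (lift ord0 i))
  (fun i => mf (lift ord0 i)) (fun i => hf (lift ord0 i)).
have H := rescales_prod (mD ord0) (c0 ord0) cl0 (mf ord0) (hf ord0) tail.
rewrite -big_ord_recl in H.
rewrite /= /tensor_step /pushforward -H//.
- congr (sfprod _ _ _); apply/seteqP; split => p /=; by rewrite tmap_cons.
- rewrite -[X in measurable X]setTI; exact: measurable_cons_pair.
- move=> p /AD /= h; split => /=.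
    by have := h ord0; rewrite /cons_pair tnth0.
  by move=> i; have := h (lift ord0 i); rewrite /cons_pair tnthS.
Qed.

(** Tonelli for products of functions of one coordinate. *)
Lemma ge0_integral_tensor {d} {T : measurableType d}
    (mu : {sigma_finite_measure set T -> \bar R}) n (f : 'I_n -> T -> R) (c : 'I_n -> R) :
  (forall i, measurable_fun [set: T] (f i)) -> (forall i x, 0 <= f i x)%R ->
  (forall i, \int[mu]_x (f i x)%:E = (c i)%:E) ->
  \int[tensor_power mu n]_s (\prod_i f i (tnth s i))%:E = (\prod_i c i)%:E.
Proof.
elim: n f c => [|n ih] f c mf f0 fc.
  rewrite big_ord0; under eq_integral do rewrite big_ord0.
  by rewrite integral_cst//= mul1e diracE in_setT.
have mF m (h : 'I_m -> T -> R) : (forall i, measurable_fun [set: T] (h i)) ->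
  measurable_fun [set: m.-tuple T] (fun s => \prod_i h i (tnth s i))%R.
  move=> mh.
  apply: measurable_prod => i _; apply: measurableT_comp => //.
  exact: measurable_tnth.
rewrite ge0_integral_pushforward//=; last 3 first.
- exact: measurable_cons_pair.
- by apply/measurable_EFinP; exact: mF.
- by move=> s _; rewrite lee_fin; exact: prodr_ge0.
rewrite preimage_setT /=.
have -> : \int[sfprod mu (tensor_power mu n)]_x (\prod_i f i (tnth (cons_pair x) i))%:E =
  \int[mu \x (tensor_power mu n)]_x (\prod_i f i (tnth (cons_pair x) i))%:E by [].
rewrite fubini_tonelli1//=; last 2 first.
- apply/measurable_EFinP.
  apply: (measurableT_comp (mF _ _ mf)).
  exact: measurable_cons_pair.
- by move=> s; rewrite lee_fin; exact: prodr_ge0.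
rewrite big_ord_recl.
transitivity (\int[mu]_x ((f ord0 x)%:E * (\prod_(i < n) c (lift ord0 i))%:E)).
  apply: eq_integral => x _; rewrite /fubini_F.
  rewrite -(ih (fun i => f (lift ord0 i)))// -ge0_integralZl//=; last 3 first.
  - apply/measurable_EFinP.
    exact: (mF n (fun i => f (lift ord0 i)) (fun i => mf _)).
  - by move=> s _; rewrite lee_fin; exact: prodr_ge0.
  - by rewrite lee_fin.
  apply: eq_integral => s _; rewrite -EFinM big_ord_recl /cons_pair/= tnth0.
  by under eq_bigr do rewrite tnthS.
rewrite ge0_integralZr//=.
- by rewrite fc.
- exact/measurable_EFinP.
- by move=> x _; rewrite lee_fin.
- rewrite lee_fin prodr_ge0// => i _.
  by rewrite -lee_fin -fc integral_ge0// => x _; rewrite lee_fin.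
Qed.

End tensor_power_theory.

(** * The Gamma integral *)

Section gamma_integral.
Context {R : realType}.
Notation leb := (@lebesgue_measure R).

Lemma cvg_pow_expR (b : R) n : 0 < b ->
  (fun r : R => r ^+ n * expR (- (b * r))) @ +oo --> (0 : R).
Proof.
move=> b0.
pose K := n.+1`!%:R / b ^+ n.+1.
have K0 : 0 < K by rewrite divr_gt0 ?exprn_gt0// ltr0n fact_gt0.
apply: (@squeeze_cvgr _ _ _ _ (fun=> 0) (fun r : R => K * r^-1)).
- near=> r.
  have r0 : 0 < r by near: r; exact: nbhs_pinfty_gt.
  rewrite mulr_ge0 ?exprn_ge0 ?expR_ge0 ?(ltW r0)//=.
  have br0 : 0 < b * r by rewrite mulr_gt0.
  rewrite expRN ler_pdivrMr ?expR_gt0//.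
  have h := expR_ge1Dxn n (ltW br0).
  have : K * r^-1 * ((b * r) ^+ n.+1 / n.+1`!%:R) <= K * r^-1 * expR (b * r).
    by rewrite ler_wpM2l//; [rewrite mulr_ge0 ?invr_ge0 ?(ltW r0) ?(ltW K0)|lra].
  apply: le_trans; rewrite le_eqVlt; apply/orP; left; apply/eqP.
  rewrite /K exprMn !exprS; field.
  by rewrite !gt_eqF// ?ltr0n ?fact_gt0// exprn_gt0.
- exact: cvg_cst.
- rewrite -[X in _ --> X](mulr0 K); apply: cvgMr.
  apply/cvgrVy; first by near=> r; rewrite invr_gt0; near: r; exact: nbhs_pinfty_gt.
  by rewrite (_ : unstable.inv_fun _ = id)//; apply/funext => r; exact: invrK.
Unshelve. all: by end_near. Qed.

Lemma is_derive_expRN (b r : R) :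
  is_derive r 1 (fun x : R => expR (- (b * x))) (- b * expR (- (b * r))).
Proof.
have h : is_derive r 1 (fun x : R => - (b * x)) (- b).
  have := is_deriveN (is_deriveZ b (is_derive_id r 1)).
  by move=> /is_derive_eq; apply; rewrite /GRing.scale/= mulr1.
have := @is_derive1_comp _ expR (fun x : R => - (b * x)) r _ _ (is_derive_expR _) h.
by rewrite mulrC.
Qed.

Lemma is_derive_pow n (r : R) :
  is_derive r 1 (fun x : R => x ^+ n) (n%:R * r ^+ n.-1).
Proof.
have := is_deriveX n (is_derive_id r 1); rewrite exprfctE.
by move=> /is_derive_eq; apply; rewrite /GRing.scale/= mulr1.
Qed.

(** Integration by parts reduces the exponent [n.+1] to [n]; a primitive that
vanishes at infinity makes the fundamental theorem applicable on the whole
half-line at once. *)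
Lemma pow_expR_primitive (b : R) n : 0 < b -> exists F : R -> R,
  [/\ forall r : R, is_derive r 1 F (r ^+ n * expR (- (b * r))),
      F @ +oo --> (0 : R) & F 0 = - (n`!%:R / b ^+ n.+1)].
Proof.
move=> b0; have b_neq0 : b != 0 by rewrite gt_eqF.
elim: n => [|n [F [dF F0 F1]]].
  exists (fun r => - b^-1 * expR (- (b * r))); split.
  - move=> r; have := is_deriveZ (- b^-1) (is_derive_expRN b r).
    by move=> /is_derive_eq; apply; rewrite /GRing.scale/= mulrA mulrNN mulVf// mul1r expr0 mul1r.
  - rewrite -[X in _ --> X](mulr0 (- b^-1)); apply: cvgMr.
    have := cvg_pow_expR 0 b0; by under eq_fun do rewrite expr0 mul1r.
  - by rewrite mulr0 oppr0 expR0 fact0 div1r mulr1.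
exists (fun r => - b^-1 * (r ^+ n.+1 * expR (- (b * r))) + n.+1%:R / b * F r); split.
- move=> r.
  have h1 := is_deriveM (is_derive_pow n.+1 r) (is_derive_expRN b r).
  have := is_deriveD (is_deriveZ (- b^-1) h1) (is_deriveZ (n.+1%:R / b) (dF r)).
  move=> /is_derive_eq; apply; rewrite /GRing.scale/= exprS; field.
  by [].
- rewrite -[X in _ --> X](addr0 0); apply: cvgD.
    rewrite -[X in _ --> X](mulr0 (- b^-1)); apply: cvgMr.
    exact: cvg_pow_expR.
  by rewrite -[X in _ --> X](mulr0 (n.+1%:R / b)); apply: cvgMr.
- rewrite F1 expr0n/= mul0r mulr0 add0r factS natrM !exprS; field.
  by rewrite b_neq0 expf_neq0.
Qed.

Lemma integral_pow_expR (b : R) n : 0 < b ->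
  (\int[leb]_(r in `[0%R, +oo[) (r ^+ n * expR (- (b * r)))%:E)%E =
  (n`!%:R / b ^+ n.+1)%:E.
Proof.
move=> b0; have [F [dF F0 F1]] := pow_expR_primitive n b0.
have cd (f : R -> R) (x a : R) : is_derive x 1 f a -> {for x, continuous f}.
  by move=> h; apply: differentiable_continuous; apply/derivable1_diffP.
rewrite (@ge0_continuous_FTC2y _ _ F 0 0)//.
- by rewrite F1 sub0e EFinN oppeK.
- by move=> x x0; rewrite mulr_ge0 ?exprn_ge0 ?expR_ge0.
- apply: continuous_subspaceT => r.
  exact: (cd _ _ _ (is_deriveM (is_derive_pow n r) (is_derive_expRN b r))).
- by apply: cvg_at_right_filter; exact: cd (dF 0).
- by move=> x _; rewrite derive1E; apply: derive_val.
Qed.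
End gamma_integral.

(** * Lebesgue measure on the complex plane in terms of the squared modulus *)

(** The measure structure of [pushforward] carries a proof of measurability that
unification does not find under further operations on measures. *)
Lemma image_measure {d d'} {T : measurableType d} {T' : measurableType d'}
    {R : realType} (mu : {measure set T -> \bar R}) (f : T -> T') :
  measurable_fun [set: T] f ->
  exists nu : {measure set T' -> \bar R}, forall A, nu A = mu (f @^-1` A).
Proof.
move=> mf.
by exists (measure_function_pushforward__canonical__measure_function_Measure mu mf).
Qed.

Section plane.
Context {R : realType}.
Notation leb := (@lebesgue_measure R).
Notation RR := (measurableTypeR R).
Local Open Scope ereal_scope.

Lemma rescales_affine (b s : R) : (0 < s)%R ->
  rescales leb leb setT s (fun x : RR => ((x - b) / s)%R : RR).
Proof.
move=> s0; pose f (x : RR) : RR := ((x - b) / s)%R; rewrite -/f.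
have mf : measurable_fun [set: RR] f.
  by apply: measurable_funM => //; apply: measurable_funB.
have si : (0 <= s^-1)%R by rewrite invr_ge0 ltW.
move=> A mA _.
have [nu nuE] := image_measure leb mf.
rewrite -nuE.
suff -> : leb A = mscale (NngNum si) nu A.
  by rewrite /mscale /= muleA -EFinM divff ?mul1e// gt_eqF.
apply: lebesgue_measure_unique => // _ [[x y]] _ <-.
rewrite /= /mscale/= nuE.
have -> : f @^-1` `]x, y]%classic = `](s * x + b)%R, (s * y + b)%R]%classic.
  apply/seteqP; split => z /=; rewrite !in_itv/= /f ltr_pdivlMr//;
  by rewrite ler_pdivrMr// ltrBrDr lerBlDr ![(s * _)%R]mulrC.
rewrite /= !lebesgue_measure_itv/= !lte_fin ltrD2r ltr_pM2l//.
case: ifPn => _; last by rewrite mule0.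
rewrite -!EFinD -EFinM; congr EFin; field.
by rewrite gt_eqF.
Qed.

Lemma measurable_norm2 : measurable_fun [set: RR * RR]
  (fun p : RR * RR => (p.1 ^+ 2 + p.2 ^+ 2)%R : RR).
Proof.
by apply: measurable_funD; apply: measurable_funX.
Qed.

(* The open disc of radius sqrt r; it is empty when r <= 0. *)
Let disc (r : R) := [set p : RR * RR | (p.1 ^+ 2 + p.2 ^+ 2 < r)%R].

Let measurable_disc r : measurable (disc r).
Proof.
rewrite -[disc r]setTI.
have -> : disc r = (fun p : RR * RR => (p.1 ^+ 2 + p.2 ^+ 2)%R : RR) @^-1` `]-oo, r[%classic.
  by apply/seteqP; split => p /=; rewrite in_itv.
exact: measurable_norm2.
Qed.

Let disc1_fin : sfprod leb leb (disc 1) \is a fin_num.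
Proof.
have sub : disc 1 `<=` (`[(-1)%R, 1%R]%classic `*` `[(-1)%R, 1%R]%classic).
  move=> [x y]; rewrite /disc/= !in_itv/= => h; split; nra.
rewrite ge0_fin_numE//.
apply: (@le_lt_trans _ _ (sfprod leb leb (`[(-1)%R, 1%R]%classic `*` `[(-1)%R, 1%R]%classic))).
  by apply: le_measure => //; rewrite inE//; exact: measurableX.
rewrite /sfprod product_measure1E//= !lebesgue_measure_itv/=.
by rewrite lte_fin ifT ?ltry//; lra.
Qed.

(* The area of the unit disc; it is identified with pi by the Gaussian integral
   in rho_pi below. *)
Let rho := fine (sfprod leb leb (disc 1)).

Let rho_ge0 : (0 <= rho)%R.
Proof. exact: fine_ge0. Qed.

Let disc_scale r : (0 < r)%R -> sfprod leb leb (disc r) = (r * rho)%:E.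
Proof.
move=> r0; have s0 : (0 < Num.sqrt r)%R by rewrite sqrtr_gt0.
have mf : measurable_fun [set: RR] (fun x : RR => ((x - 0) / Num.sqrt r)%R : RR).
  by apply: measurable_funM => //; apply: measurable_funB.
have h := rescales_affine 0 s0.
have := rescales_prod measurableT (ltW s0) (ltW s0) mf h h.
rewrite setXTT => /(_ _ (measurable_disc 1)) /(_ (@subsetT _ _)).
rewrite -expr2 sqr_sqrtr ?ltW// /rho EFinM fineK// => <-.
congr (sfprod _ _ _); apply/seteqP; split => -[x y]; rewrite /disc/=;
  by rewrite !subr0 !expr_div_n sqr_sqrtr ?ltW// -mulrDl ltr_pdivrMr// mul1r.
Qed.

Let rescales_norm2_rho : rescales (sfprod leb leb) leb `[0%R, +oo[ rho
  (fun p : RR * RR => (p.1 ^+ 2 + p.2 ^+ 2)%R : RR).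
Proof.
move=> A mA A0; pose f (p : RR * RR) : RR := (p.1 ^+ 2 + p.2 ^+ 2)%R.
rewrite -/f.
have mf : measurable_fun [set: RR * RR] f by exact: measurable_norm2.
have m0 : measurable (`[0%R, +oo[%classic : set RR) by [].
have -> : leb A = mrestr leb m0 A by rewrite /mrestr; congr (leb _); apply/esym/setIidPl.
have [mu muE] := image_measure (sfprod leb leb) mf.
suff : mu A = mscale (NngNum rho_ge0) (mrestr leb m0) A by rewrite muE.
(* Two measures that are finite and equal on the rays ]-oo, r[ are equal. *)
apply: (@measure_unique _ R RR (@RGenInftyO.G R) (fun n => `]-oo, n%:R[%classic)) => //.
- exact: RGenInftyO.measurableE.
- move=> _ _ [x ->] [y ->]; exists (Num.min x y).
  by apply/seteqP; split => z /=; rewrite !in_itv/= lt_min => /andP.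
- by move=> n; exists n%:R.
- apply/seteqP; split => // x _; exists (Num.truncn `|x|).+1 => //=.
  rewrite in_itv/= (le_lt_trans (ler_norm x))//.
  exact: truncnS_gt.
- move=> _ [r ->]; rewrite /= /mscale/= muE /=.
  have -> : f @^-1` `]-oo, r[%classic = disc r.
    by apply/seteqP; split => p /=; rewrite in_itv.
  rewrite /mrestr.
  have [r0|r0] := ltP 0%R r.
    rewrite disc_scale//.
    have -> : (`]-oo, r[ `&` `[0%R, +oo[ = `[0%R, r[)%classic.
      apply/seteqP; split => z /=; rewrite !in_itv/= andbT.
        by move=> [-> ->].
      by move=> /andP[-> ->].
    by rewrite lebesgue_measure_itv/= lte_fin r0 sube0 -EFinM mulrC.
  have -> : disc r = set0.
    rewrite -subset0 => -[x y]; rewrite /disc/= => h.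
    have := lt_le_trans h r0; rewrite ltNge; apply/negP; rewrite negbK.
    by rewrite addr_ge0// sqr_ge0.
  have -> : (`]-oo, r[ `&` `[0%R, +oo[ = set0)%classic.
    rewrite -subset0 => z /=; rewrite !in_itv/= andbT => -[h1 h2].
    have := lt_le_trans h1 r0; lra.
  by rewrite !measure0 mule0.
- move=> n; rewrite muE /=; have -> : f @^-1` `]-oo, n%:R[%classic = disc n%:R.
    by apply/seteqP; split => p /=; rewrite in_itv.
  apply: (@le_lt_trans _ _ (sfprod leb leb (disc n.+1%:R))).
    apply: le_measure; rewrite ?inE//.
    by move=> p /= /lt_le_trans; apply; rewrite ler_nat.
  by rewrite disc_scale// ltry.
Qed.

Let integral_norm2_rho (b : R) n : (0 < b)%R ->
  \int[sfprod leb leb]_p ((p.1 ^+ 2 + p.2 ^+ 2) ^+ n *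
     expR (- (b * (p.1 ^+ 2 + p.2 ^+ 2))))%:E = (rho * (n`!%:R / b ^+ n.+1))%:E.
Proof.
move=> b0; pose h := (fun r : RR => (r ^+ n * expR (- (b * r)))%:E) \_ (`[0%R, +oo[%classic).
have m0 : measurable (`[0%R, +oo[%classic : set RR) by [].
have mh : measurable_fun [set: RR] (fun r : RR => (r ^+ n * expR (- (b * r)))%:E).
  apply/measurable_EFinP/measurable_funM; first exact: measurable_funX.
  apply: (measurableT_comp (@measurable_expR R)).
  by apply: measurableT_comp => //; exact: measurable_funM.
transitivity (\int[sfprod leb leb]_p h (p.1 ^+ 2 + p.2 ^+ 2)%R).
  apply: eq_integral => p _; rewrite /h patchE ifT// inE/= in_itv/= andbT.
  by rewrite addr_ge0// sqr_ge0.
rewrite (ge0_integral_rescales m0 rho_ge0 measurable_norm2 rescales_norm2_rho).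
- by rewrite -integral_mkcond integral_pow_expR// EFinM.
- by apply/(measurable_restrictT _ _).1 => //; exact: measurable_funS mh.
- move=> y; rewrite /h patchE; case: ifPn => //.
  rewrite inE/= in_itv/= andbT => y0.
  by rewrite lee_fin mulr_ge0 ?exprn_ge0 ?expR_ge0.
- by move=> y yD; rewrite /h patchE ifF//; apply/negbTE; rewrite notin_setE.
Qed.

(* The integral of exp(- x^2 - y^2) over the plane is rho by the change of
   variable x^2 + y^2, and the square of the Gaussian integral by Tonelli. *)
Let rho_pi : rho = pi.
Proof.
have := @integral_norm2_rho 1 0 ltr01.
rewrite fact0 expr1 divr1 mulr1 => h; apply: EFin_inj; rewrite -h.
transitivity (\int[leb \x leb]_p (gauss_fun p.1 * gauss_fun p.2 : R)%:E).
  rewrite -[LHS]/(\int[leb \x leb]_p _); apply: eq_integral => p _.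
  by rewrite expr0 !mul1r opprD expRD.
rewrite fubini_tonelli1//=; last 2 first.
- apply/measurable_EFinP/measurable_funM.
    apply: measurableT_comp => //; exact: measurable_gauss_fun.
  apply: measurableT_comp => //; exact: measurable_gauss_fun.
- by move=> p; rewrite lee_fin mulr_ge0 ?gauss_fun_ge0.
transitivity (\int[leb]_x ((gauss_fun x)%:E * (Num.sqrt pi)%:E)).
  apply: eq_integral => x _; rewrite /fubini_F -integralT_gauss -ge0_integralZl//=.
  - by apply/measurable_EFinP; exact: measurable_gauss_fun.
  - by move=> y _; rewrite lee_fin gauss_fun_ge0.
  - by rewrite lee_fin gauss_fun_ge0.
rewrite ge0_integralZr//=.
- by rewrite integralT_gauss -EFinM -expr2 sqr_sqrtr// pi_ge0.
- by apply/measurable_EFinP; exact: measurable_gauss_fun.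
- by move=> y _; rewrite lee_fin gauss_fun_ge0.
Qed.

(** This replaces polar coordinates: discs have area proportional to the square
of their radius, and the Gaussian integral gives the constant. *)
Lemma rescales_norm2 : rescales (sfprod leb leb) leb `[0%R, +oo[ pi
  (fun p : RR * RR => (p.1 ^+ 2 + p.2 ^+ 2)%R : RR).
Proof. by rewrite -rho_pi; exact: rescales_norm2_rho. Qed.

Lemma integral_norm2 (b : R) n : (0 < b)%R ->
  \int[sfprod leb leb]_p ((p.1 ^+ 2 + p.2 ^+ 2) ^+ n *
     expR (- (b * (p.1 ^+ 2 + p.2 ^+ 2))))%:E = (pi * (n`!%:R / b ^+ n.+1))%:E.
Proof. by rewrite -rho_pi; exact: integral_norm2_rho. Qed.

End plane.

(** * Second-order bounds for the logarithm *)

Section logarithm_bounds.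
Context {R : realType}.
Implicit Types u x : R.

Let le_of_derive_ge0 (f df : R -> R) (x y : R) : 0 < x -> x <= y ->
  (forall u, 0 < u -> is_derive u 1 f (df u)) ->
  (forall u, 0 < u -> 0 <= df u) -> f x <= f y.
Proof.
move=> x0 xy fdf df0.
have [c cxy E] : exists2 c, c \in `[x, y] & f y - f x = df c * (y - x).
  apply: (@MVT_segment _ f df) => //.
    by move=> u; rewrite in_itv/= => /andP[xu _]; apply: fdf; exact: lt_trans xu.
  apply: derivable_within_continuous => u; rewrite in_itv/= => /andP[xu _].
  by have [] := fdf u (lt_le_trans x0 xu).
rewrite -subr_ge0 E mulr_ge0 ?subr_ge0// df0//.
by move: cxy; rewrite in_itv/= => /andP[xc _]; exact: lt_le_trans xc.
Qed.

(* Both functions vanish at 1, and their derivatives (u - 1)^2 / (2 u^2) and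
   (u - 1)^2 / u are nonnegative; all later bounds on ln come from them. *)
Let chord u := (u - u^-1) / 2 - ln u.
Let parabola u := (u - 1) ^+ 2 / 2 - (u - 1) + ln u.

Let chord_mono x y : 0 < x -> x <= y -> chord x <= chord y.
Proof.
move=> x0 xy; apply: (le_of_derive_ge0 (df := fun u => (u - 1) ^+ 2 / (2 * u ^+ 2)) x0 xy) => u u0.
  have hV := is_deriveV (lt0r_neq0 u0) (is_derive_id u 1).
  have := is_deriveB (is_deriveZ 2^-1 (is_deriveB (is_derive_id u 1) hV)) (is_derive1_ln u0).
  have -> : (2^-1 \*: (@id R - (fun y => (id y)^-1)) - @ln R)%R = chord.
    by apply/funext => v; rewrite /chord/= mulrC.
  move=> /is_derive_eq; apply; rewrite /GRing.scale/=; field; rewrite lt0r_neq0//.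
by apply: divr_ge0; rewrite ?sqr_ge0// mulr_ge0 ?sqr_ge0.
Qed.

Let parabola_mono x y : 0 < x -> x <= y -> parabola x <= parabola y.
Proof.
move=> x0 xy; apply: (le_of_derive_ge0 (df := fun u => (u - 1) ^+ 2 / u) x0 xy) => u u0.
  have h1 := is_deriveB (is_derive_id u 1) (is_derive_cst (1 : R) u 1).
  have := is_deriveD (is_deriveB (is_deriveZ 2^-1 (is_deriveM h1 h1)) h1) (is_derive1_ln u0).
  rewrite [X in is_derive _ _ X _](_ : _ = parabola); last first.
    by apply/funext => v; rewrite /parabola expr2 [_ / 2]mulrC.
  move=> /is_derive_eq; apply; rewrite /GRing.scale/=.
  by rewrite -[(_ - _) u]/(u - 1); field; rewrite lt0r_neq0.
by apply: divr_ge0; rewrite ?sqr_ge0 ?ltW.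
Qed.

Let chord1 : chord 1 = 0. Proof. by rewrite /chord invr1 subrr mul0r ln1 subrr. Qed.
Let parabola1 : parabola 1 = 0.
Proof. by rewrite /parabola subrr expr0n/= mul0r ln1 subr0 addr0. Qed.

Lemma ln_ub u : 1 <= u -> ln u <= (u - u^-1) / 2.
Proof. by move=> u1; have := chord_mono ltr01 u1; rewrite chord1 /chord subr_ge0. Qed.

Lemma ln_lb u : 1 <= u -> u - 1 - (u - 1) ^+ 2 / 2 <= ln u.
Proof. by move=> u1; have := parabola_mono ltr01 u1; rewrite parabola1 /parabola; lra. Qed.

(** The rate function of the problem: the quotient of r^k exp(- N r) at
r = u k / N by its maximum, at r = k / N, is exp (- k * rel_entropy u). *)
Definition rel_entropy u := u - 1 - ln u.

(** This bound holds on the whole half-line: it both gives the quadratic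
behaviour near 1 and forces [u] to be near 1 when [rel_entropy u] is small. *)
Lemma rel_entropy_ge u : 0 < u ->
  (u - 1) ^+ 2 / (2 * (1 + `|u - 1|)) <= rel_entropy u.
Proof.
move=> u0; rewrite /rel_entropy; have [u1|u1] := leP 1 u.
  rewrite ger0_norm ?subr_ge0// [1 + _]addrC subrK.
  have := ln_ub u1; rewrite -subr_ge0 => h.
  rewrite -subr_ge0 (le_trans h)// le_eqVlt; apply/orP; left; apply/eqP.
  by field; rewrite lt0r_neq0.
have h := parabola_mono u0 (ltW u1); rewrite parabola1 /parabola in h.
apply: (@le_trans _ _ ((u - 1) ^+ 2 / 2)); last lra.
rewrite ler_wpM2l ?sqr_ge0// lef_pV2 ?posrE//; have := normr_ge0 (u - 1); lra.
Qed.

Lemma rel_entropy_le u : 0 < u -> `|u - 1| < 1 ->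
  rel_entropy u <= (u - 1) ^+ 2 / (2 * (1 - `|u - 1|)).
Proof.
move=> u0 h1; rewrite /rel_entropy; have [u1|u1] := leP 1 u.
  apply: (@le_trans _ _ ((u - 1) ^+ 2 / 2)); first by have := ln_lb u1; lra.
  rewrite ler_wpM2l ?sqr_ge0// lef_pV2 ?posrE//; have := normr_ge0 (u - 1); lra.
have h := chord_mono u0 (ltW u1); rewrite chord1 /chord in h.
rewrite ltr0_norm ?subr_lt0// opprK [1 + _]addrC subrK.
rewrite -subr_ge0.
rewrite (_ : _ - _ = - ((u - u^-1) / 2 - ln u)); first lra.
by field; rewrite lt0r_neq0.
Qed.

(** The logarithm of k! / (k^(k + 1/2) e^(- k)) changes from [k] to [k.+1] by
1 - (k + 1/2) ln (1 + 1/k), which is at most (1/k - 1/(k + 1)) / 2 in absolute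
value; these increments telescope. *)
Lemma stirling_bound k : (0 < k)%N ->
  `|ln k`!%:R - (k%:R + 2^-1) * ln k%:R + k%:R - 1 : R| <= (1 - k%:R^-1) / 2.
Proof.
case: k => // k _; elim: k => [|k ih].
  by rewrite factS fact0 ln1 mulr0 subr0 add0r subrr normr0 invr1 subrr mul0r.
set n := k.+1 in ih *; have n0 : 0 < n%:R :> R by rewrite ltr0n.
have nS : n.+1%:R = n%:R + 1 :> R by rewrite -natr1.
have u1 : 1 <= 1 + n%:R^-1 :> R by rewrite lerDl invr_ge0 ltW.
have lnE : ln (1 + n%:R^-1) = ln (n%:R + 1) - ln n%:R :> R.
  rewrite -ln_div ?posrE ?addr_gt0//; congr ln; field.
  by rewrite lt0r_neq0.
have ub := ln_ub u1; have lb := ln_lb u1.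
rewrite lnE in ub lb.
rewrite factS natrM lnM ?posrE ?ltr0n ?fact_gt0// nS.
move: ih; set F := ln _; set x := n%:R in n0 u1 lnE ub lb *.
set A := ln x in lb ub *; set B := ln (x + 1) in lb ub *.
move=> ih.
have x1 : 1 <= x by rewrite /x ler1n.
have ub' : (x + 2^-1) * (B - A) <= 1 + (x^-1 - (x + 1)^-1) / 2.
  apply: (@le_trans _ _ ((x + 2^-1) * ((1 + x^-1 - (1 + x^-1)^-1) / 2))).
    by rewrite ler_wpM2l//; lra.
  rewrite -subr_ge0 (_ : _ - _ = (x * (x + 1))^-1 / 4); last first.
    by field; rewrite !lt0r_neq0//; lra.
  by rewrite divr_ge0// invr_ge0 mulr_ge0; lra.
have lb' : 1 - (x^-1 - (x + 1)^-1) / 2 <= (x + 2^-1) * (B - A).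
  apply: le_trans (_ : (x + 2^-1) * (1 + x^-1 - 1 - (1 + x^-1 - 1) ^+ 2 / 2) <= _); last first.
    by rewrite ler_wpM2l//; lra.
  rewrite -subr_ge0 (_ : _ - _ = (x - 1) / (4 * x ^+ 2 * (x + 1))); last first.
    by field; rewrite !lt0r_neq0//; lra.
  by rewrite divr_ge0 ?subr_ge0// !mulr_ge0 ?sqr_ge0//; lra.
move: ih; rewrite !ler_norml => /andP[ih1 ih2]; apply/andP; split; lra.
Qed.

End logarithm_bounds.

(** * The sections in radial coordinates *)

Section pointwise_norm.
Context {R : realType} {d : nat}.
Notation leb := (@lebesgue_measure R).
Notation RR := (measurableTypeR R).
Implicit Types (p : d.-tuple (RR * RR)%type) (i : 'I_d).

Definition norm2 (w : RR * RR) : R := w.1 ^+ 2 + w.2 ^+ 2.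

Lemma norm2_ge0 w : 0 <= norm2 w.
Proof. by rewrite addr_ge0 ?sqr_ge0. Qed.

Lemma normc_of_coords p i : Normc.normc (of_coords p 0 i) ^+ 2 = norm2 (tnth p i).
Proof. by rewrite mxE /= sqr_sqrtr// norm2_ge0. Qed.

Definition radial_monomial (N k : nat) (r : R) : R := r ^+ k * expR (- (N%:R * r)).

Lemma density_of_coords N (k : 'I_d -> nat) p :
  density N k (of_coords p) = \prod_i radial_monomial N (k i) (norm2 (tnth p i)).
Proof.
rewrite /density /radial_monomial big_split/= -expR_sum; congr (_ * expR _); last first.
  rewrite /sqnorm mulr_sumr -sumrN; apply: eq_bigr => i _.
  by rewrite normc_of_coords.
rewrite /monomial.
rewrite (big_morph _ (@Normc.normcM R) (Normc.normc1 R)) -prodrXl; apply: eq_bigr => i _.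
rewrite -normc_of_coords -!exprM mulnC exprM.
congr (_ ^+ _).
elim: (k i) => [|n ih]; first by rewrite !expr0 Normc.normc1.
by rewrite !exprS Normc.normcM ih.
Qed.

Lemma sq_const_val N (k : 'I_d -> nat) : (0 < N)%N ->
  sq_const N k = \prod_i (pi * ((k i)`!%:R / N%:R ^+ (k i).+1)) :> R.
Proof.
move=> N0; rewrite /sq_const /Rintegral.
under eq_integral do rewrite density_of_coords.
rewrite /lebesgueC.
rewrite (@ge0_integral_tensor _ _ _ _ d (fun i w => radial_monomial N (k i) (norm2 w))
  (fun i => pi * ((k i)`!%:R / N%:R ^+ (k i).+1)))//.
- move=> i; apply: measurable_funM.
    by apply: measurable_funX; exact: measurable_norm2.
  apply: (measurableT_comp (@measurable_expR R)).
  apply: measurableT_comp => //; apply: measurable_funM => //.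
  exact: measurable_norm2.
- by move=> i w; rewrite mulr_ge0 ?exprn_ge0 ?expR_ge0 ?norm2_ge0.
- by move=> i; rewrite -integral_norm2 ?ltr0n.
Qed.

(** The factor of <s_k, s_k> that depends on one coordinate, as a function of the
squared modulus; pi k! / N^(k + 1) is the corresponding factor of c_{N,k}^2. *)
Definition radial_density (N k : nat) (r : R) : R :=
  (pi * (k`!%:R / N%:R ^+ k.+1))^-1 * radial_monomial N k r.

Lemma pointwise_sqnorm_of_coords N (k : 'I_d -> nat) p : (0 < N)%N ->
  pointwise_sqnorm N k (of_coords p) = \prod_i radial_density N (k i) (norm2 (tnth p i)).
Proof.
move=> N0; rewrite /pointwise_sqnorm sq_const_val// density_of_coords.
by rewrite -prodfV -big_split.
Qed.

Lemma measurable_radial_density N k : measurable_fun [set: RR] (radial_density N k : RR -> RR).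
Proof.
apply: measurable_funM => //; apply: measurable_funM; first exact: measurable_funX.
apply: (measurableT_comp (@measurable_expR R)).
by apply: measurableT_comp => //; exact: measurable_funM.
Qed.

End pointwise_norm.

Section ln_radial.
Context {R : realType}.

Lemma radial_density_gt0 N k (r : R) : (0 < N)%N -> 0 < r -> 0 < radial_density N k r.
Proof.
move=> N0 r0; apply: mulr_gt0.
  rewrite invr_gt0; apply: mulr_gt0; first exact: pi_gt0.
  by apply: divr_gt0; rewrite ?exprn_gt0 ?ltr0n ?fact_gt0.
by apply: mulr_gt0; [exact: exprn_gt0|exact: expR_gt0].
Qed.

(** At r = a u with k = N a, the logarithm is exactly
  (ln N) / 2 - (ln a) / 2 - ln pi - k phi(u) - ln (k! / (k^(k + 1/2) e^(- k))),
and the last logarithm is between 1/2 and 3/2 by [stirling_bound]. *)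
Lemma ln_radial_density N k (a u : R) : (0 < N)%N -> (0 < k)%N -> k%:R = N%:R * a ->
  0 < u ->
  `|ln (radial_density N k (a * u)) - (2^-1 * ln N%:R - k%:R * rel_entropy u)|
    <= 2^-1 * `|ln a| + `|ln pi| + 3 / 2.
Proof.
move=> N0 k0 kE u0.
have N0' : 0 < N%:R :> R by rewrite ltr0n.
have k0' : 0 < k%:R :> R by rewrite ltr0n.
have a0 : 0 < a by move: k0'; rewrite kE pmulr_rgt0.
have f0 : 0 < k`!%:R :> R by rewrite ltr0n fact_gt0.
have p0 : 0 < pi :> R by exact: pi_gt0.
have Nk0 : 0 < N%:R ^+ k.+1 :> R by exact: exprn_gt0.
have q0 := divr_gt0 f0 Nk0; have c0 := mulr_gt0 p0 q0.
have au0 := mulr_gt0 a0 u0; have g0 := exprn_gt0 k au0.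
have e0 := expR_gt0 (- (N%:R * (a * u))).
have -> : ln (radial_density N k (a * u)) = - (ln pi + (ln k`!%:R - k.+1%:R * ln N%:R)) +
    (k%:R * (ln a + ln u) - N%:R * (a * u)).
  rewrite /radial_density /radial_monomial lnM ?posrE ?invr_gt0 ?(mulr_gt0 g0 e0)// lnV ?posrE//.
  rewrite (lnM p0 q0) (ln_div f0 Nk0) (lnM g0 e0) expRK !lnXn// (lnM a0 u0).
  by rewrite -[ln N%:R *+ _]mulr_natl -[(_ + _) *+ _]mulr_natl.
have := @stirling_bound R _ k0.
have lk : ln k%:R = ln N%:R + ln a :> R by rewrite kE lnM ?posrE.
have ki : 0 < k%:R^-1 :> R by rewrite invr_gt0.
rewrite -[k.+1%:R]natr1 lk /rel_entropy mulrA -kE.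
set x := k%:R : R; set f := ln _; set n := ln N%:R; set b := ln a; set P := ln pi; set l := ln u.
move=> h.
have -> : - (P + (f - (x + 1) * n)) + (x * (b + l) - x * u) - (2^-1 * n - x * (u - 1 - l)) =
  - P - 2^-1 * b - 1 - (f - (x + 2^-1) * (n + b) + x - 1) by field.
have hb := ler_norm b; have hb' := ler_norm (- b); rewrite normrN in hb'.
have hP := ler_norm P; have hP' := ler_norm (- P); rewrite normrN in hP'.
move: h; rewrite !ler_norml => /andP[h1 h2]; apply/andP; split; lra.
Qed.
End ln_radial.

(** * Volumes of Euclidean balls *)

Section ball_volume.
Context {R : realType}.
Notation leb := (@lebesgue_measure R).
Notation RR := (measurableTypeR R).
Variable n : nat.
Implicit Types x : n.-tuple RR.

Definition eball (r : R) : set (n.-tuple RR) :=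
  [set x | \sum_(i < n) (tnth x i : R) ^+ 2 <= r ^+ 2].

Lemma measurable_forall_tnth (D : 'I_n -> set RR) :
  (forall i, measurable (D i)) -> measurable [set x | forall i, D i (tnth x i)].
Proof.
move=> mD.
have -> : [set x | forall i, D i (tnth x i)] =
    \bigcap_(i in [set: 'I_n]) ((fun x : n.-tuple RR => tnth x i) @^-1` D i).
  by apply/seteqP; split => [x h i _|x h i]; [exact: h|exact: (h i I)].
apply: fin_bigcap_measurable => // i _.
by rewrite -[X in measurable X]setTI; exact: measurable_tnth.
Qed.

Lemma measurable_eball r : measurable (eball r).
Proof.
have mf : measurable_fun [set: n.-tuple RR]
    (fun x : n.-tuple RR => (\sum_(i < n) (tnth x i : R) ^+ 2) : RR).
  by apply: measurable_sum => i; apply: measurable_funX; exact: measurable_tnth.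
have -> : eball r = (fun x : n.-tuple RR => (\sum_(i < n) (tnth x i : R) ^+ 2) : RR)
    @^-1` `]-oo, r ^+ 2].
  by apply/seteqP; split => x; rewrite /eball/= in_itv.
by rewrite -[X in measurable X]setTI; exact: mf.
Qed.

(** Cubes bound the volume of the unit ball from both sides, which gives that it
is finite and nonzero. *)
Lemma lebesgueR_cube (c : R) : 0 < c ->
  lebesgueR n [set x | forall i, `[- c, c]%classic (tnth x i)] = ((2 * c) ^+ n)%:E.
Proof.
move=> c0; set C := [set x | _].
have mI : measurable (`[- c, c]%classic : set RR) by [].
have mC : measurable C by exact: (measurable_forall_tnth (fun=> mI)).
(* The indicator of the cube is the product of the indicators of its sides. *)
rewrite -[C]setIT -integral_indic// -[in RHS](card_ord n) -prodr_const.
have := @ge0_integral_tensor _ _ _ leb n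
  (fun _ => \1_(`[- c, c]%classic : set RR)) (fun _ => 2 * c).
move=> <- //.
- apply: eq_integral => x _; congr EFin; rewrite indicE.
  have [xC|xC] := boolP (x \in C).
    rewrite big1// => i _; rewrite indicE; move: xC; rewrite inE => /(_ i) h.
    by rewrite mem_set.
  have [i hi] : exists i, ~ `[- c, c]%classic (tnth x i).
    by apply: contrapT => /forallNP h; move: xC; rewrite notin_setE; apply=> i; apply: contrapT.
  by rewrite (bigD1 i)//= indicE memNset// mul0r.
- move=> i; rewrite integral_indic// setIT /= lebesgue_measure_itv/= lte_fin ifT; last lra.
  by rewrite -EFinD; congr EFin; lra.
Qed.

Lemma unit_ball_volume_fin : lebesgueR n (eball 1) = (unit_ball_volume R n)%:E.
Proof.
rewrite /unit_ball_volume /eball expr1n fineK// ge0_fin_numE//.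
apply: (@le_lt_trans _ _ (lebesgueR n [set x | forall i, `[- 1, 1]%classic (tnth x i)])).
  apply: le_measure; rewrite ?inE//.
  - by have := measurable_eball 1; rewrite /eball expr1n.
  - exact: (@measurable_forall_tnth (fun=> `[- 1, 1]%classic)).
  move=> x /= h i; rewrite in_itv/= -ler_norml -(@expr_le1 _ 2)// real_normK ?num_real//.
  by apply: le_trans h; rewrite (bigD1 i)//= lerDl sumr_ge0// => j _; exact: sqr_ge0.
by rewrite lebesgueR_cube// ltry.
Qed.

Lemma unit_ball_volume_gt0 : 0 < unit_ball_volume R n.
Proof.
(* The cube of half-side c lies in the unit ball because n c^2 <= 1. *)
pose c : R := (n.+1%:R)^-1.
have c0 : 0 < c by rewrite invr_gt0 ltr0n.
rewrite -lte_fin -unit_ball_volume_fin.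
apply: (@lt_le_trans _ _ (lebesgueR n [set x | forall i, `[- c, c]%classic (tnth x i)])).
  by rewrite lebesgueR_cube// lte_fin exprn_gt0// mulr_gt0.
apply: le_measure; rewrite ?inE//.
- exact: (@measurable_forall_tnth (fun=> `[- c, c]%classic)).
- exact: measurable_eball.
move=> x h; rewrite /eball/= expr1n.
apply: (@le_trans _ _ (\sum_(i < n) c ^+ 2)).
  apply: ler_sum => i _; rewrite -real_normK ?num_real// lerXn2r ?nnegrE ?(ltW c0)//.
  by have := h i; rewrite /= in_itv/= -ler_norml.
rewrite sumr_const card_ord -mulr_natr /c expr2 -mulrA.
have n0 : 0 < n.+1%:R :> R by rewrite ltr0n.
rewrite mulrC ler_pdivrMr// mul1r ler_pdivrMl//.
have : 1 <= n.+1%:R :> R by rewrite ler1n.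
have : n%:R <= n.+1%:R :> R by rewrite ler_nat.
nra.
Qed.

Lemma lebesgueR_eball r : 0 < r ->
  lebesgueR n (eball r) = (r ^+ n * unit_ball_volume R n)%:E.
Proof.
move=> r0; rewrite EFinM -unit_ball_volume_fin.
have mf : measurable_fun [set: RR] (fun x : RR => ((x - 0) / r)%R : RR).
  by apply: measurable_funM => //; apply: measurable_funB.
have := @rescales_tensor _ _ _ _ _ leb leb n (fun=> setT) (fun=> r)
  (fun _ (y : RR) => ((y - 0) / r : RR)).
move=> /(_ (fun=> measurableT) (fun=> ltW r0) (fun=> mf) (fun=> rescales_affine 0 r0)).
move=> /(_ _ (measurable_eball 1)).
rewrite prodr_const card_ord => <-//.
congr (lebesgueR _ _); apply/seteqP; split => x; rewrite /eball/= expr1n.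
  move=> h; under eq_bigr do rewrite tnth_mktuple subr0 expr_div_n.
  by rewrite -mulr_suml ler_pdivrMr ?exprn_gt0// mul1r.
under eq_bigr do rewrite tnth_mktuple subr0 expr_div_n.
by rewrite -mulr_suml ler_pdivrMr ?exprn_gt0// mul1r.
Qed.
End ball_volume.
Arguments eball {R} n r.

(** * Sublevel sets of the rate function are nearly balls *)

Section sandwich.
Context {R : realType}.

(** With d2 = d (ln N) / N, the relation a_i (u_i - 1)^2 = d2 v_i^2 defines the
rescaled coordinates [v].  The smallness of d2 makes |u_i - 1| <= e on the unit
ball, where [rel_entropy] is (u - 1)^2 / 2 up to the factor 1 / (1 - e). *)
Lemma sum_rel_entropy_le (n : nat) (a u v : 'I_n -> R) (d2 e : R) :
  (forall i, 0 < a i) -> 0 < d2 -> 0 < e ->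
  (forall i, d2 * (1 + e) ^+ 2 <= a i * e ^+ 2) ->
  (forall i, a i * (u i - 1) ^+ 2 = d2 * v i ^+ 2) ->
  e < 1 -> \sum_i v i ^+ 2 <= (1 - e) ^+ 2 ->
  (forall i, 0 < u i) /\ \sum_i a i * rel_entropy (u i) <= d2 * (1 - e) / 2.
Proof.
move=> a0 d20 e0 d2a uv e1 hv.
have hu i : `|u i - 1| <= e.
  have vi : v i ^+ 2 <= 1.
    apply: (@le_trans _ _ (\sum_i v i ^+ 2)).
      by rewrite (bigD1 i)//= lerDl sumr_ge0// => j _; exact: sqr_ge0.
    apply: le_trans hv _; rewrite expr_le1//; lra.
  rewrite -ler_sqr ?nnegrE ?(ltW e0)// real_normK ?num_real//.
  rewrite -(ler_pM2l (a0 i)) uv; apply: le_trans (d2a i).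
  rewrite ler_pM2l//; apply: le_trans vi _.
  by rewrite expr_ge1 ?addr_ge0 ?lerDl ?(ltW e0).
have u0 i : 0 < u i by have := hu i; rewrite ler_norml; lra.
split => //.
apply: (@le_trans _ _ (\sum_i d2 / (2 * (1 - e)) * v i ^+ 2)).
  apply: ler_sum => i _.
  have h := rel_entropy_le (u0 i) (le_lt_trans (hu i) e1).
  apply: (@le_trans _ _ (a i * ((u i - 1) ^+ 2 / (2 * (1 - e))))).
    rewrite ler_pM2l//; apply: le_trans h _.
    rewrite ler_wpM2l ?sqr_ge0// lef_pV2 ?posrE; have := hu i; lra.
  by rewrite mulrA uv mulrAC.
rewrite -mulr_sumr.
apply: (@le_trans _ _ (d2 / (2 * (1 - e)) * (1 - e) ^+ 2)).
  by rewrite ler_wpM2l// divr_ge0 ?(ltW d20)//; lra.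
rewrite le_eqVlt; apply/orP; left; apply/eqP; field; lra.
Qed.

(** Every term of the sum is nonnegative, so each of them is small, and by
[rel_entropy_ge] every [u i] is within [e] of 1; there the quadratic lower bound
loses only the factor 1 + e. *)
Lemma sum_sq_le (n : nat) (a u v : 'I_n -> R) (d2 e : R) :
  (forall i, 0 < a i) -> 0 < d2 -> 0 < e ->
  (forall i, d2 * (1 + e) ^+ 2 <= a i * e ^+ 2) ->
  (forall i, a i * (u i - 1) ^+ 2 = d2 * v i ^+ 2) ->
  (forall i, 0 < u i) ->
  \sum_i a i * rel_entropy (u i) <= d2 * (1 + e) / 2 ->
  \sum_i v i ^+ 2 <= (1 + e) ^+ 2.
Proof.
move=> a0 d20 e0 d2a uv u0 hs.
have t0 i : 0 <= rel_entropy (u i).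
  apply: le_trans (rel_entropy_ge (u0 i)).
  by rewrite divr_ge0 ?sqr_ge0// mulr_ge0// addr_ge0.
have hu i : `|u i - 1| <= e.
  set h := `|u i - 1|.
  have h0 : 0 <= h by exact: normr_ge0.
  have hh : h ^+ 2 = (u i - 1) ^+ 2 by rewrite real_normK ?num_real.
  have s1 : a i * rel_entropy (u i) <= d2 * (1 + e) / 2.
    apply: le_trans hs; rewrite (bigD1 i)//= lerDl sumr_ge0// => j _.
    by rewrite mulr_ge0 ?(ltW (a0 j)).
  have s2 : a i * h ^+ 2 <= d2 * (1 + e) * (1 + h).
    have := rel_entropy_ge (u0 i); rewrite -/h -hh ler_pdivrMr; last lra.
    move=> s2; have := a0 i; nra.
  (* h^2 / (1 + h) is increasing in h, so s3 forces h <= e. *)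
  have s3 : h ^+ 2 * (1 + e) <= e ^+ 2 * (1 + h).
    rewrite -(ler_pM2l (a0 i)).
    apply: (@le_trans _ _ (d2 * (1 + e) ^+ 2 * (1 + h))).
      rewrite mulrA (le_trans (ler_wpM2r _ s2))//; first lra.
      by rewrite le_eqVlt; apply/orP; left; apply/eqP; ring.
    by rewrite [leRHS]mulrA ler_wpM2r//; lra.
  rewrite leNgt; apply/negP => he.
  have : 0 < (h - e) * (h + e + e * h) by rewrite mulr_gt0//; nra.
  nra.
rewrite -(ler_pM2l d20) mulr_sumr.
apply: (@le_trans _ _ (\sum_i 2 * (1 + e) * (a i * rel_entropy (u i)))).
  apply: ler_sum => i _; rewrite -uv [leRHS]mulrCA ler_pM2l//.
  have := rel_entropy_ge (u0 i); rewrite ler_pdivrMr; last by have := normr_ge0 (u i - 1); lra.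
  move/le_trans; apply; rewrite mulrC ler_wpM2r//; have := hu i; lra.
rewrite -mulr_sumr.
apply: (@le_trans _ _ (2 * (1 + e) * (d2 * (1 + e) / 2))).
  by rewrite ler_wpM2l//; lra.
rewrite le_eqVlt; apply/orP; left; apply/eqP; by field.
Qed.
End sandwich.

(** * The superlevel set in rescaled coordinates *)

Section rescaled_tail.
Context {R : realType} {d : nat}.
Notation leb := (@lebesgue_measure R).
Notation RR := (measurableTypeR R).
Variables (N : nat) (k : 'I_d -> nat) (t : R) (a s : 'I_d -> R).
Implicit Types v : d.-tuple RR.

(** The region <s_k, s_k> >= t in the coordinates v_i = (|z_i|^2 - a_i) / s_i,
which range over the half-lines 0 <= a_i + s_i v_i. *)
Definition rescaled_tail_set : set (d.-tuple RR) :=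
  [set v | (forall i, 0 <= a i + s i * tnth v i) /\
           t <= \prod_i radial_density N (k i) (a i + s i * tnth v i)].

Lemma measurable_affine (b c : R) : measurable_fun [set: RR] (fun x : RR => (b + c * x : RR)).
Proof. by apply: measurable_funD => //; exact: measurable_funM. Qed.

Lemma measurable_nneg_affine i : measurable [set x : RR | 0 <= a i + s i * x].
Proof.
have -> : [set x : RR | 0 <= a i + s i * x] =
    (fun x : RR => (a i + s i * x : RR)) @^-1` `[0, +oo[%classic.
  by apply/seteqP; split => x /=; rewrite in_itv/= andbT.
by rewrite -[X in measurable X]setTI; exact: measurable_affine.
Qed.

Lemma measurable_rescaled_tail_set : measurable rescaled_tail_set.
Proof.
have mf : measurable_fun [set: d.-tuple RR]
    (fun v => (\prod_i radial_density N (k i) (a i + s i * tnth v i) : RR)).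
  apply: measurable_prod => i _.
  apply: (measurableT_comp (measurable_radial_density N (k i))).
  apply: (measurableT_comp (measurable_affine (a i) (s i))).
  exact: measurable_tnth.
have mt : measurable [set v | t <= \prod_i radial_density N (k i) (a i + s i * tnth v i)].
  rewrite (_ : [set _ | _] =
    (fun v => (\prod_i radial_density N (k i) (a i + s i * tnth v i) : RR))
      @^-1` `[t, +oo[%classic).
    by rewrite -[X in measurable X]setTI; exact: mf.
  by apply/seteqP; split => x /=; rewrite in_itv/= andbT.
exact: measurableI (measurable_forall_tnth measurable_nneg_affine) mt.
Qed.

(** Each coordinate z_i |-> v_i is the squared modulus followed by an affine map,
hence contributes the factor pi * s_i. *)
Lemma sigma_tail_rescaled : (0 < N)%N -> (forall i, 0 < s i) ->
  sigma_tail N k t =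
  ((pi ^+ d * \prod_i s i)%:E * lebesgueR d rescaled_tail_set)%E.
Proof.
move=> N0 s0.
pose f i (w : RR * RR) : RR := (norm2 w - a i) / s i.
have mg i : measurable_fun [set: RR] (fun x : RR => ((x - a i) / s i : RR)).
  by apply: measurable_funM => //; apply: measurable_funB.
have fK i w : a i + s i * f i w = norm2 w.
  by rewrite /f mulrCA divff ?lt0r_neq0// mulr1 addrC subrK.
have mf i : measurable_fun [set: RR * RR] (f i).
  by apply: (measurableT_comp (mg i)); exact: measurable_norm2.
have hf i : rescales (sfprod leb leb) leb [set x : RR | 0 <= a i + s i * x] (pi * s i) (f i).
  apply: (@rescales_comp R _ _ _ _ _ _ _ leb leb `[0, +oo[%classic _ _ _
    (@norm2 R) (fun x : RR => ((x - a i) / s i : RR))) => //.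
  - move=> x /=; rewrite in_itv/= andbT mulrCA divff ?lt0r_neq0// mulr1 addrC subrK//.
  - exact: rescales_norm2.
  - by move=> A mA _; exact: (rescales_affine (a i) (s0 i)).
have := rescales_tensor measurable_nneg_affine
  (fun i => mulr_ge0 (pi_ge0 R) (ltW (s0 i))) mf hf measurable_rescaled_tail_set.
rewrite big_split/= prodr_const card_ord => <-; last by move=> v [].
rewrite /sigma_tail /lebesgueC; congr (tensor_power _ _ _).
apply/seteqP; split => p /=; rewrite pointwise_sqnorm_of_coords// /rescaled_tail_set/=.
  move=> h; split.
    by move=> i; rewrite tnth_mktuple fK norm2_ge0.
  by under eq_bigr do rewrite tnth_mktuple fK.
by move=> [_]; under eq_bigr do rewrite tnth_mktuple fK.
Qed.

(** A bound, independent of [N], for the deviation of ln <s_k, s_k> - ln t from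
(d/2) ln N - N sum_i a_i phi(u_i). *)
Definition log_error : R :=
  \sum_i (2^-1 * `|ln (a i)| + `|ln pi| + 3 / 2) + `|ln t|.

Hypothesis N1 : (1 < N)%N.
Hypothesis t0 : 0 < t.
Hypothesis a0 : forall i, 0 < a i.
Hypothesis kE : forall i, (k i)%:R = N%:R * a i.
Let d2 := d%:R * ln N%:R / N%:R : R.

Let Ngt0 : 0 < N%:R :> R. Proof. by rewrite ltr0n ltnW. Qed.

Let k0 i : (0 < k i)%N.
Proof. by rewrite -(ltr0n R) kE mulr_gt0. Qed.

Let sum_ln_radial_density u : (forall i, 0 < u i) ->
  `|\sum_i ln (radial_density N (k i) (a i * u i)) -
    (N%:R * d2 / 2 - N%:R * \sum_i a i * rel_entropy (u i))| + `|ln t| <= log_error.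
Proof.
move=> u0; rewrite /log_error lerD2r.
have -> : N%:R * d2 / 2 = \sum_(i < d) 2^-1 * ln N%:R :> R.
  rewrite sumr_const card_ord -[RHS]mulr_natl /d2; field.
  exact: lt0r_neq0.
rewrite mulr_sumr -!sumrB; apply: le_trans (ler_norm_sum _ _ _) _.
apply: ler_sum => i _.
have := ln_radial_density (ltnW N1) (k0 i) (kE i) (u0 i).
by rewrite kE mulrA.
Qed.

Let le_prod_radial_density u : (forall i, 0 < u i) ->
  (t <= \prod_i radial_density N (k i) (a i * u i)) =
  (ln t <= \sum_i ln (radial_density N (k i) (a i * u i))).
Proof.
move=> u0.
have w0 i : 0 < radial_density N (k i) (a i * u i) by rewrite radial_density_gt0 ?mulr_gt0// ltnW.
rewrite -{1}(lnK t0) -[in RHS]ler_expR expR_sum.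
by under [in RHS]eq_bigr do rewrite lnK ?posrE//.
Qed.

Hypothesis d0 : (0 < d)%N.
Hypothesis sE : forall i, s i = Num.sqrt (a i * (d%:R / N%:R) * ln N%:R).

Let d2_gt0 : 0 < d2.
Proof. by rewrite /d2 divr_gt0 ?mulr_gt0 ?ln_gt0 ?ltr1n ?ltr0n ?(ltnW N1). Qed.

Let sqr_s i : s i ^+ 2 = a i * d2.
Proof.
have -> : s i = Num.sqrt (a i * d2) by rewrite sE /d2; congr Num.sqrt; ring.
by rewrite sqr_sqrtr// mulr_ge0 ?(ltW (a0 i)) ?(ltW d2_gt0).
Qed.

Let u v i := 1 + s i * tnth v i / a i.

Let a_u v i : a i * u v i = a i + s i * tnth v i.
Proof. by rewrite /u mulrDr mulr1 mulrCA divff ?mulr1 ?lt0r_neq0. Qed.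

Let sqr_u v i : a i * (u v i - 1) ^+ 2 = d2 * tnth v i ^+ 2.
Proof.
rewrite /u addrC addKr expr_div_n exprMn sqr_s; field.
exact: lt0r_neq0.
Qed.

Lemma scale_gt0 i : 0 < s i.
Proof.
rewrite sE sqrtr_gt0 mulr_gt0 ?ln_gt0 ?ltr1n// mulr_gt0//.
by rewrite divr_gt0 ?ltr0n ?(ltnW N1).
Qed.

Variable e : R.
Hypothesis e0 : 0 < e.
(* The smallness conditions on N: d (ln N) / N is small compared with the a_i,
   and the bounded error is small compared with ln N. *)
Hypothesis d2a : forall i, d2 * (1 + e) ^+ 2 <= a i * e ^+ 2.
Hypothesis err : 2 * log_error <= e * (d%:R * ln N%:R).

Let Nd2 : N%:R * d2 = d%:R * ln N%:R.
Proof. by rewrite /d2 mulrCA divff ?mulr1 ?lt0r_neq0. Qed.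

Lemma eball_sub_tail : e < 1 -> eball d (1 - e) `<=` rescaled_tail_set.
Proof.
move=> e1 v hv.
have [u0 hs] := sum_rel_entropy_le a0 d2_gt0 e0 d2a (sqr_u v) e1 hv.
split.
  by move=> i; rewrite -a_u mulr_ge0 ?(ltW (a0 i)) ?(ltW (u0 i)).
under eq_bigr do rewrite -a_u.
rewrite le_prod_radial_density//.
have := sum_ln_radial_density u0.
set S := \sum_i ln _; set T := \sum_i a i * _ in hs *.
have : N%:R * T <= N%:R * (d2 * (1 - e) / 2) by rewrite ler_pM2l.
have -> : N%:R * (d2 * (1 - e) / 2) = N%:R * d2 * (1 - e) / 2 by ring.
rewrite Nd2; move: err; set C := log_error; set L := d%:R * _; set M := N%:R * T.
move=> h1 h2 h3; have := ler_norm (- (S - (L / 2 - M))); rewrite normrN.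
by have := ler_norm (ln t); lra.
Qed.

(** Since k_i > 0 and t > 0, the density vanishes where some z_i does, so the
logarithms of the u_i are meaningful on the whole region. *)
Lemma tail_sub_eball : rescaled_tail_set `<=` eball d (1 + e).
Proof.
move=> v [r0 ht].
have u0 i : 0 < u v i.
  rewrite -(pmulr_rgt0 _ (a0 i)) a_u lt0r r0 andbT; apply/eqP => ri0.
  move: ht; rewrite (bigD1 i)//= ri0 /radial_density /radial_monomial expr0n.
  by rewrite -[_ == _]negbK -lt0n k0/= mul0r mulr0 mul0r leNgt t0.
move: ht; under eq_bigr do rewrite -a_u.
rewrite le_prod_radial_density// => ht.
apply: (sum_sq_le a0 d2_gt0 e0 d2a (sqr_u v) u0).
rewrite -(ler_pM2l Ngt0).
have -> : N%:R * (d2 * (1 + e) / 2) = N%:R * d2 * (1 + e) / 2 by ring.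
move: err ht (sum_ln_radial_density u0); rewrite !Nd2.
set S := \sum_i ln _; set T := \sum_i a i * _.
set C := log_error; set L := d%:R * _; set M := N%:R * T.
move=> h1 h2 h3; have := ler_norm (S - (L / 2 - M)).
by have := ler_norm (- ln t); rewrite normrN; lra.
Qed.

End rescaled_tail.

(** * The limit *)

Section limit.
Context {R : realType}.

Lemma near_ln_ge (A : R) : \forall N \near \oo, A <= ln N%:R.
Proof.
near=> N.
have h : expR A <= N%:R by near: N; exact: nbhs_infty_ger.
by rewrite -[A]expRK ler_ln// posrE ?expR_gt0// (lt_le_trans (expR_gt0 A) h).
Unshelve. all: by end_near. Qed.

Lemma near_ln_div_le (A : R) : 0 < A -> \forall N \near \oo, ln N%:R / N%:R <= A.
Proof.
move=> A0; near=> N.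
have h : (2 / A) ^+ 2 <= N%:R by near: N; exact: nbhs_infty_ger.
have A2 : 0 < 2 / A by rewrite divr_gt0.
have N0 : 0 < N%:R :> R by rewrite (lt_le_trans _ h)// exprn_gt0.
(* ln N = 2 ln (sqrt N) <= 2 sqrt N *)
set x : R := Num.sqrt N%:R.
have x0 : 0 < x by rewrite sqrtr_gt0.
have xE : N%:R = x ^+ 2 by rewrite sqr_sqrtr// ltW.
have Ax : 2 / A <= x.
  by rewrite -ler_sqr ?nnegrE ?(ltW A2) ?(ltW x0)// -xE.
rewrite xE lnXn// ler_pdivrMr ?exprn_gt0//.
have := ltW (ln_sublinear x0).
move: Ax; rewrite ler_pdivrMr// => Ax lx.
rewrite -mulr_natl expr2 mulrA [A * x]mulrC.
by apply: (@le_trans _ _ (2 * x)); [rewrite ler_pM2l|rewrite ler_pM2r].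
Unshelve. all: by end_near. Qed.

Lemma near_pow_1 (n : nat) (e : R) : 0 < e ->
  exists2 x, 0 < x < 1 & 1 - e <= (1 - x) ^+ n /\ (1 + x) ^+ n <= 1 + e.
Proof.
move=> e0.
have c (b : R) : (fun x : R => (1 + b * x) ^+ n) x @[x --> (0 : R)^'+] --> (1 : R).
  apply: cvg_at_right_filter.
  have : {for 0, continuous (fun x : R => (1 + b * x) ^+ n)}.
    apply: (@continuous_comp _ _ _ (fun x => 1 + b * x) (fun y => y ^+ n));
      last exact: exprn_continuous.
    by apply: continuousD; [exact: cst_continuous|
      apply: continuousM; [exact: cst_continuous|exact: cvg_id]].
  by rewrite /prop_for /continuous_at /= mulr0 addr0 expr1n.
have h1 : \forall x \near (0 : R)^'+, `|1 - (1 + 1 * x) ^+ n| <= e.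
  by move/cvgrPdist_le: (c 1); apply.
have h2 : \forall x \near (0 : R)^'+, `|1 - (1 + -1 * x) ^+ n| <= e.
  by move/cvgrPdist_le: (c (-1)); apply.
have [x [x01 [hx1 hx2]]] : exists x, 0 < x < 1 /\
   (`|1 - (1 + 1 * x) ^+ n| <= e /\ `|1 - (1 + -1 * x) ^+ n| <= e).
  apply: (@filter_ex _ (0 : R)^'+).
  near=> x; split.
    by apply/andP; split; near: x; [exact: nbhs_right_gt|exact: nbhs_right_lt].
  by split; near: x.
exists x => //; move: hx1 hx2; rewrite mul1r mulN1r !ler_norml; lra.
Unshelve. all: by end_near. Qed.

End limit.

Theorem mainTheorem3 (R : realType) (d : nat) (hd : (0 < d)%N)
  (G : subtorus R d) (g : {vspace 'rV[R]_d}) (hg : lie_algebra_of G g)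
  (lam : 'Hom(subvs_of g, R^o)) (hlam : is_weight lam)
  (hred : compact_toric_reduction G lam)
  (a : 'rV[R]_d) (ha : polytope lam a) (ha_pos : forall i, 0 < a 0 i)
  (t : R) (ht : 0 < t)
  (k : nat -> 'I_d -> nat)
  (hk : forall N, admissible a N -> forall i, (k N i)%:R = N%:R * a 0 i) :
  (fun N : nat =>
     fine (sigma_tail N (k N) t) /
     (pi ^+ d * unit_ball_volume R d *
      \prod_(i < d) Num.sqrt (a 0 i * (d%:R / N%:R) * ln N%:R)))
    @ within [set N | admissible a N] \oo --> (1 : R).
Proof.
pose aa (i : 'I_d) := a 0 i.
pose s N (i : 'I_d) := Num.sqrt (a 0 i * (d%:R / N%:R) * ln N%:R).
set V := unit_ball_volume R d.
have V0 : 0 < V by exact: unit_ball_volume_gt0.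
apply/cvgrPdist_le => e e0.
(* The radii 1 - x and 1 + x change volumes by factors within e of 1. *)
have [x /andP[x0 x1] [xl xu]] := near_pow_1 d e0.
rewrite near_withinE; near=> N => Nadm.
have [N0 _] := Nadm; have kE := hk _ Nadm.
have N1 : (1 < N)%N by near: N; exact: nbhs_infty_gt.
have d2a i : d%:R * ln N%:R / N%:R * (1 + x) ^+ 2 <= aa i * x ^+ 2.
  have h : ln N%:R / N%:R <= aa i * x ^+ 2 / (1 + x) ^+ 2 / d%:R.
    move: (i); near: N; apply: filter_forall => i'.
    apply: near_ln_div_le; rewrite !divr_gt0 ?ltr0n ?exprn_gt0 ?addr_gt0//.
    by rewrite mulr_gt0 ?exprn_gt0//; exact: ha_pos.
  have dd : 0 < d%:R :> R by rewrite ltr0n.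
  have xx : 0 < (1 + x) ^+ 2 by rewrite exprn_gt0 ?addr_gt0.
  by rewrite -ler_pdivlMr// -mulrA mulrC -ler_pdivlMr.
have err : 2 * log_error t aa <= x * (d%:R * ln N%:R).
  have h : 2 * log_error t aa / (x * d%:R) <= ln N%:R by near: N; exact: near_ln_ge.
  by rewrite mulrA [leRHS]mulrC -ler_pdivrMr ?mulr_gt0 ?ltr0n.
have lo := eball_sub_tail N1 ht ha_pos kE hd (fun i => erefl (s N i)) x0 d2a err x1.
have hi := tail_sub_eball N1 ht ha_pos kE hd (fun i => erefl (s N i)) x0 d2a err.
have s0 := scale_gt0 N1 ha_pos hd (fun i => erefl (s N i)).
have mE := measurable_rescaled_tail_set N (k N) t aa (s N).
move: lo hi mE (sigma_tail_rescaled (k N) t aa N0 s0); set E := rescaled_tail_set _ _ _ _ _.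
move=> lo hi mE ->.
have x1' : 0 < 1 - x by rewrite subr_gt0.
have x2' : 0 < 1 + x by rewrite addr_gt0.
have loE : (((1 - x) ^+ d * V)%:E <= lebesgueR d E)%E.
  rewrite -lebesgueR_eball//; apply: le_measure; rewrite ?inE//.
  exact: measurable_eball.
have hiE : (lebesgueR d E <= ((1 + x) ^+ d * V)%:E)%E.
  rewrite -lebesgueR_eball//; apply: le_measure; rewrite ?inE//.
  exact: measurable_eball.
have Efin : lebesgueR d E \is a fin_num.
  by rewrite ge0_fin_numE// (le_lt_trans hiE)// ltry.
rewrite -(fineK Efin) in loE hiE *; rewrite !lee_fin in loE hiE.
set m := fine _ in loE hiE *; rewrite -EFinM /=.
have Ps : 0 < pi ^+ d * \prod_i s N i :> R.
  by rewrite mulr_gt0 ?exprn_gt0 ?pi_gt0 ?prodr_gt0.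
(* The factors pi and s_i cancel: the ratio compares the rescaled region with the
   unit ball. *)
have -> : pi ^+ d * \prod_i s N i * m / (pi ^+ d * V * \prod_i s N i) = m / V.
  by rewrite [pi ^+ d * V]mulrC -[V * _ * _]mulrA [V * _]mulrC -mulf_div divff ?mul1r ?lt0r_neq0.
have ml : (1 - x) ^+ d <= m / V by rewrite ler_pdivlMr.
have mu : m / V <= (1 + x) ^+ d by rewrite ler_pdivrMr.
by rewrite ler_norml; lra.
Unshelve. all: by end_near.
Qed.
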